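(* Let $(N,v)$ be the MCST-saving game defined by a non-negatively weighted complete graph $\langle K[N_r],w\rangle$, where $N=\{1,\dots,n\}$ and $N_r=N\cup\{r\}$, and assume that every player of $(N,v)$ is non-null. Let $H$ be the number of mutually distinct positive edge weights, i.e. the cardinality of $\{\gamma\in\mathbb R\mid \exists\{i,j\}\subseteq N_r,\ \gamma=w(i,j)>0\}$. Let $\phi$ be the Shapley value of $(N,v)$ and let $\phi^A=(\phi^A_1,\dots,\phi^A_n)$ be the random vector $\phi^A_i=\frac1M\sum_{m=1}^M\bigl(v(\mathrm{Prc}(\pi^{(m)},i)\cup\{i\})-v(\mathrm{Prc}(\pi^{(m)},i))\bigr)$, where $M$ is a positive integer and $\pi^{(1)},\dots,\pi^{(M)}$ are independent uniformly random permutations of $N$. Then, for any $\varepsilon>0$ and $0<\delta<1$: (1) If $\displaystyle M\ge\frac{n^2(n-1)^4\ln(2H/\delta)}{2\varepsilon^2}$, then each player $i\in N$ satisfies $$\Pr\left[\frac{|\phi^A_i-\phi_i|}{\phi_i}<\varepsilon\right]\ge 1-\delta.$$ (2) If $\displaystyle M\ge\frac{n^2(n-1)^4\ln(2nH/\delta)}{2\varepsilon^2}$, then $$\Pr\left[\forall i\in N,\ \frac{|\phi^A_i-\phi_i|}{\phi_i}<\varepsilon\right]\ge 1-\delta.$$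
   Context: Let $N=\{1,\dots,n\}$ be a set of players, $r\notin N$ a distinguished node (the root), and $N_r=N\cup\{r\}$. $K[V]$ denotes the undirected complete graph on vertex set $V$. A non-negatively weighted complete graph $\langle K[N_r],w\rangle$ consists of $K[N_r]$ together with a weight $w(i,j)=w(j,i)\ge 0$ for each edge $\{i,j\}$. For non-empty $S\subseteq N$, $c(S)$ is the minimum of $\sum_{e\in T}w(e)$ over all spanning trees $T$ (identified with their edge sets) of $K[S\cup\{r\}]$, and $c(\emptyset)=0$. The pair $(N,c)$ is the MCST (minimum cost spanning tree) game. The associated MCST-saving game $(N,v)$ is defined by $v(S)=\sum_{i\in S}c(\{i\})-c(S)=\sum_{i\in S}w(r,i)-c(S)$, $v(\emptyset)=0$. Player $i$ is a null player of $(N,v)$ if $v(S\cup\{i\})=v(S)$ for all $S\subseteq N\setminus\{i\}$; otherwise $i$ is non-null. (Non-null players have positive Shapley value.) A permutation of $N$ is a bijection $\pi:\{1,\dots,n\}\to N$; $\Pi_N$ is the set of all of them. $\mathrm{Prc}(\pi,i)$ is the set of players preceding $i$ in $\pi$. The Shapley value of $(N,v)$ is $\phi_i=\frac{1}{n!}\sum_{\pi\in\Pi_N}\bigl(v(\mathrm{Prc}(\pi,i)\cup\{i\})-v(\mathrm{Prc}(\pi,i))\bigr)$ for $i\in N$. *)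

(* Defs.v *)
From mathcomp Require Import all_boot all_order all_algebra perm.
From mathcomp Require Import all_classical all_reals all_analysis.
Set Implicit Arguments.
Unset Strict Implicit.
Unset Printing Implicit Defensive.
Import Order.TTheory GRing.Theory Num.Theory.
Local Open Scope classical_set_scope.
Local Open Scope ring_scope.

(* An edge of a graph on V is a two-element set of vertices, so that an edge
   weighting w : {set V} -> R is symmetric by construction; its values at sets
   that do not have exactly two elements are never used. *)
Section Graphs.
Variable V : finType.

Definition complete_edges (U : {set V}) : {set {set V}} :=
  [set e : {set V} | (e \subset U) && (#|e| == 2%N)]%SET.

Definition adj (T : {set {set V}}) : rel V :=
  fun x y => (x != y) && ([set x; y]%SET \in T).

Definition connected_on (U : {set V}) (T : {set {set V}}) : Prop :=
  {in U &, forall x y, connect (adj T) x y}.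

(* The bound 2 discards the closed walk x, y, x along a single edge. *)
Definition acyclic (T : {set {set V}}) : Prop :=
  forall c : seq V, ucycle (adj T) c -> (size c <= 2)%N.

Definition spanning_tree (U : {set V}) (T : {set {set V}}) : Prop :=
  [/\ T \subset complete_edges U, connected_on U T & acyclic T].

End Graphs.

Section Games.
Variables (R : realType) (n : nat).
Implicit Types (v : {set 'I_n} -> R) (S : {set 'I_n}) (s : 'S_n).

Definition null_player v (i : 'I_n) : Prop :=
  forall S, i \notin S -> v (i |: S)%SET = v S.

(* s k is the player at position k. *)
Definition Prc s (i : 'I_n) : {set 'I_n} :=
  [set j : 'I_n | (s^-1%g j < s^-1%g i)%N]%SET.

Definition marginal v s (i : 'I_n) : R :=
  v (i |: Prc s i)%SET - v (Prc s i).

Definition shapley v (i : 'I_n) : R :=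
  n`!%:R^-1 * \sum_(s : 'S_n) marginal v s i.

Definition shapley_estimate v (M : nat) (p : 'I_M -> 'S_n) (i : 'I_n) : R :=
  M%:R^-1 * \sum_(m < M) marginal v (p m) i.

End Games.

(* The nodes N_r: Some i is player i, None is the root r. *)
Notation node n := (option 'I_n).

Definition with_root n (S : {set 'I_n}) : {set node n} :=
  (None |: [set Some i | i in S])%SET.

Section MCST.
Variables (R : realType) (n : nat) (w : {set node n} -> R).
Implicit Types (S : {set 'I_n}) (T : {set {set node n}}).

Definition edge_set_weight T : R := \sum_(e in T) w e.

(* The infimum is over a finite nonempty set, hence a minimum; see
   mcst_cost_min. *)
Definition mcst_cost S : R :=
  if S == finset.set0 then 0 else
  inf [set edge_set_weight T | T in [set T | spanning_tree (with_root S) T]].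

Definition mcst_saving S : R :=
  \sum_(i in S) mcst_cost [set i]%SET - mcst_cost S.

Definition num_pos_weights : nat :=
  size (undup [seq w e | e <- enum (complete_edges [set: node n]%SET) & 0 < w e]).

End MCST.

Section CostIsMinimum.
Variables (R : realType) (n : nat) (w : {set node n} -> R).
Implicit Types (S : {set 'I_n}) (T : {set {set node n}}).

Definition star S : {set {set node n}} :=
  [set [set None; Some i]%SET | i in S]%SET.

Lemma star_adj S x y : adj (star S) x y -> (x == None) (+) (y == None).
Proof.
case/andP=> xy /imsetP[i _] E.
have := set21 x y; have := set22 x y; rewrite E !inE.
by move=> /orP[]/eqP ? /orP[]/eqP ?; subst x y; rewrite ?eqxx in xy *.
Qed.

Lemma star_spanning S : spanning_tree (with_root S) (star S).
Proof.
have root_adj i : i \in S -> adj (star S) None (Some i).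
  by move=> iS; rewrite /adj /=; apply/imsetP; exists i.
have adj_sym : symmetric (adj (star S)).
  by move=> x y; rewrite /adj eq_sym finset.setUC.
split.
- apply/fintype.subsetP => e /imsetP[i iS ->]; rewrite inE cards2 /= andbT.
  apply/fintype.subsetP => x; rewrite !inE => /orP[]/eqP -> //=.
  by rewrite imset_f.
- have toroot x : x \in with_root S -> connect (adj (star S)) None x.
    rewrite !inE => /orP[/eqP->|/imsetP[i iS ->]]; first exact: connect0.
    exact/connect1/root_adj.
  move=> x y xS yS; apply: connect_trans (toroot _ yS).
  by rewrite sym_connect_sym //; exact: toroot.
- case=> [|x [|y [|z c]]] // /andP[/= /and3P[/star_adj xy /star_adj yz zc]].
  rewrite !inE !negb_or => /and3P[/and3P[Nxy Nxz _] /andP[_ yc] _].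
  have [t [Nty /star_adj zt]] : exists t, t != y /\ adj (star S) z t.
    case: c zc yc => [|t c] /= /andP[zt _]; first by exists x.
    by rewrite inE negb_or eq_sym => /andP[? _]; exists t.
  by case: x y z t xy yz zt Nxz Nty {Nxy zc yc} => [x|] [y|] [z|] [t|].
Qed.

Lemma mcst_cost_min S :
  (exists2 T, spanning_tree (with_root S) T & mcst_cost w S = edge_set_weight w T)
  /\ (forall T, spanning_tree (with_root S) T ->
        mcst_cost w S <= edge_set_weight w T).
Proof.
rewrite /mcst_cost; case: eqP => [->|_].
  have no_edge : complete_edges (with_root finset.set0) = finset.set0 :> {set {set node n}}.
    apply/setP => e; rewrite !inE; apply/negP => /andP[/subset_leq_card].
    rewrite /with_root imset0 finset.setU0 cards1 => le1 /eqP e2.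
    by rewrite e2 in le1.
  have empty_tree T : spanning_tree (with_root finset.set0) T -> T = finset.set0.
    by case=> + _ _; rewrite no_edge finset.subset0 => /eqP.
  split=> [|T /empty_tree ->]; last by rewrite /edge_set_weight big_set0.
  have st := star_spanning finset.set0.
  by exists (star finset.set0) => //; rewrite (empty_tree _ st) /edge_set_weight big_set0.
have star_ts : `[< spanning_tree (with_root S) (star S) >].
  exact/asboolP/star_spanning.
have [T0 /asboolP tT0 T0min] := @arg_minP _ _ _ (star S)
  (fun T => `[< spanning_tree (with_root S) T >]) (edge_set_weight w) star_ts.
have lbT0 : lbound [set edge_set_weight w T | T in
    [set T | spanning_tree (with_root S) T]] (edge_set_weight w T0).
  by move=> _ [T tT <-]; apply/T0min/asboolP.
have infE : inf [set edge_set_weight w T | T in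
    [set T | spanning_tree (with_root S) T]] = edge_set_weight w T0.
  apply/eqP; rewrite eq_le; apply/andP; split.
    by apply: ge_inf; [exists (edge_set_weight w T0)|exists T0].
  by apply: lb_le_inf => //; exists (edge_set_weight w T0); exists T0.
by rewrite infE; split=> [|T tT]; [exists T0|apply: lbT0; exists T].
Qed.

End CostIsMinimum.

Section RandomPermutations.
Variables (R : realType) (d : measure_display) (Omega : measurableType d).
Variables (P : probability Omega R) (n M : nat).
Implicit Type X : 'I_M -> Omega -> 'S_n.

(* Random variables for the discrete sigma-algebra on 'S_n. *)
Definition random_perms X : Prop :=
  forall m (B : set 'S_n), measurable (X m @^-1` B).

Definition uniform_perms X : Prop :=
  forall m (s : 'S_n), P (X m @^-1` [set s]) = (n`!%:R^-1)%:E.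

Definition independent_perms X : Prop :=
  forall (J : {set 'I_M}) (B : 'I_M -> set 'S_n),
    P (\bigcap_(m in [set` J]) (X m @^-1` B m)) =
    (\prod_(m in J) P (X m @^-1` B m))%E.

End RandomPermutations.

(* Main.v *)
(* Let g_1 < ... < g_H be the positive edge weights and g_0 = 0. Writing
   w = sum_h (g_h - g_(h-1)) [w >= g_h] and using that Kruskal's tree is optimal
   at every threshold simultaneously, the saving game becomes
   v = sum_h (g_h - g_(h-1)) v_h, where v_h is the saving game of the 0-1
   weighting [w >= g_h]. The marginals of v_h are integers in [0, n-1], and a
   player who is non-null in v_h already has marginal at least 1 on some
   singleton {j}; the (n-2)! orders starting with j, i then give
   phi_i(v_h) >= 1/(n(n-1)). Hoeffding's inequality bounds the relative error in
   each v_h, a union bound over h (and over i) combines them, and relative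
   errors below eps add up to a relative error below eps.

   Numbers of components are replaced by ranks over the field with two elements:
   an edge {x, y} becomes the vector 1_x + 1_y, and the span of a set of edges
   contains 1_x + 1_y exactly when these edges connect x and y. *)
Require Import Defs.
From mathcomp Require Import all_boot all_order all_algebra perm.
From mathcomp Require Import all_classical all_reals all_analysis.
From mathcomp Require Import ring lra.
Import Order.TTheory GRing.Theory Num.Theory.
Local Open Scope classical_set_scope.
Local Open Scope ring_scope.
Set Implicit Arguments.
Unset Strict Implicit.
Unset Printing Implicit Defensive.

(** * Graphic rank over the field with two elements *)

Section EdgeSpace.
Variable V : finType.
Implicit Types (F : {set {set V}}) (U e : {set V}) (x y z : V).

Definition vertex_vec x : {ffun V -> ('F_2)^o} := [ffun z => (z == x)%:R].

Definition edge_vec e : {ffun V -> ('F_2)^o} := [ffun z => (z \in e)%:R].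

Definition edge_span F : {vspace {ffun V -> ('F_2)^o}} :=
  (\sum_(e in F) <[edge_vec e]>)%VS.

(** The rank in the graphic matroid: for a set of two-element edges, the number of vertices minus
    the number of components. *)
Definition edge_rank F : nat := \dim (edge_span F).

Lemma edge_vec_in_span F e : e \in F -> edge_vec e \in edge_span F.
Proof. by move=> eF; rewrite memvE; apply: (sumv_sup e). Qed.

Lemma edge_span_sub F (W : {vspace {ffun V -> ('F_2)^o}}) :
  {in F, forall e, edge_vec e \in W} -> (edge_span F <= W)%VS.
Proof. by move=> FW; apply/subv_sumP => e /FW; rewrite memvE. Qed.

Lemma edge_spanS F F' : F \subset F' -> (edge_span F <= edge_span F')%VS.
Proof.
move=> /fintype.subsetP sFF'; apply: edge_span_sub => e /sFF'.
exact: edge_vec_in_span.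
Qed.

Lemma edge_rankS F F' : F \subset F' -> (edge_rank F <= edge_rank F')%N.
Proof. by move=> /edge_spanS/dimvS. Qed.

Lemma edge_span_setU F F' :
  (edge_span (F :|: F') <= edge_span F + edge_span F')%VS.
Proof.
apply: edge_span_sub => e; rewrite inE => /orP[] /edge_vec_in_span eF.
  exact: (subvP (addvSl _ _)).
exact: (subvP (addvSr _ _)).
Qed.

Lemma edge_rank_card F : (edge_rank F <= #|F|)%N.
Proof.
apply: leq_trans (dimv_leq_sum _ _ _) _; rewrite -sum1_card.
by apply: leq_sum => e _; rewrite dim_vline leq_b1.
Qed.

Lemma edge_rank_setU F F' : (edge_rank (F :|: F') <= edge_rank F + #|F'|)%N.
Proof.
apply: leq_trans (dimvS (edge_span_setU F F')) _.
apply: leq_trans (leq_of_leqif (dimv_add_leqif _ _)) _.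
by rewrite leq_add2l edge_rank_card.
Qed.

Lemma edge_span_setU1 e F :
  edge_span (e |: F) = (<[edge_vec e]> + edge_span F)%VS.
Proof.
apply/eqP; rewrite eqEsubv; apply/andP; split.
  by apply: subv_trans (edge_span_setU _ _) _; rewrite /edge_span big_set1.
rewrite subv_add edge_spanS ?finset.subsetUr // andbT.
by rewrite -memvE edge_vec_in_span ?finset.setU11.
Qed.

Lemma edge_rank_setU1 e F :
  edge_vec e \notin edge_span F -> edge_rank (e |: F) = (edge_rank F).+1.
Proof.
move=> eF; rewrite /edge_rank edge_span_setU1 dimv_disjoint_sum.
  rewrite dim_vline; case: eqP => // e0.
  by rewrite e0 mem0v in eF.
apply/eqP; rewrite -subv0; apply/subvP => u /memv_capP[/vlineP[k ->]].
by rewrite rpredZeq (negbTE eF) orbF => /eqP->; rewrite scale0r mem0v.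
Qed.

Lemma edge_spanP F u : u \in edge_span F ->
  exists k : {set V} -> 'F_2, u = \sum_(e in F) k e *: edge_vec e.
Proof.
move=> /memv_sumP[us usF ->].
have k_ex e : exists k, e \in F -> us e = k *: edge_vec e.
  have [/usF/vlineP[k ->]|_] := boolP (e \in F); first by exists k.
  by exists 0.
exists (fun e => sval (cid (k_ex e))); apply: eq_bigr => e eF.
by case: cid => k /= ->.
Qed.

Lemma edge_span_support U F u x : F \subset complete_edges U ->
  x \notin U -> u \in edge_span F -> u x = 0.
Proof.
move=> /fintype.subsetP FU xU /edge_spanP[k ->].
rewrite sum_ffunE big1 // => e /FU; rewrite inE => /andP[/fintype.subsetP eU _].
rewrite !ffunE; case: (boolP (x \in e)) => [/eU|_]; first by rewrite (negbTE xU).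
by rewrite scaler0.
Qed.

(** Every vector of the span vanishes at [x], where [edge_vec e] is 1. Edges at a newly joining
    player are thus independent of the older ones. *)
Lemma edge_span_notin U F x e : F \subset complete_edges U ->
  x \notin U -> x \in e -> edge_vec e \notin edge_span F.
Proof.
move=> FU xU xe; apply/negP => /(edge_span_support FU xU)/eqP.
by rewrite ffunE xe oner_eq0.
Qed.

Lemma edge_vec_set2 x y : x != y ->
  edge_vec [set x; y]%SET = vertex_vec x + vertex_vec y.
Proof.
move=> xy; apply/ffunP => z; rewrite !ffunE !inE.
by have [->|zx] := eqVneq z x; rewrite ?(negbTE xy) ?addr0 ?add0r.
Qed.

Lemma F2_addv_self (u : {ffun V -> ('F_2)^o}) : u + u = 0.
Proof.
apply/ffunP => z; rewrite !ffunE.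
by rewrite -mulr2n -mulr_natr (_ : 2%:R = 0 :> 'F_2) ?mulr0 //; apply: val_inj.
Qed.

(** Along a path the edge vectors telescope: each inner vertex occurs twice and cancels modulo 2. *)
Lemma connect_edge_span F x y : connect (adj F) x y ->
  vertex_vec x + vertex_vec y \in edge_span F.
Proof.
move=> /connectP[p + ->]; elim: p x => [|z p IHp] x /=.
  by rewrite F2_addv_self mem0v.
move=> /andP[/andP[xz xzF] /IHp zp].
have := memvD (edge_vec_in_span xzF) zp.
by rewrite edge_vec_set2 // -addrA (addrA (vertex_vec z)) F2_addv_self add0r.
Qed.

Lemma adj_sym F : symmetric (adj F).
Proof. by move=> x y; rewrite /adj eq_sym finset.setUC. Qed.

(* The indicator of the component of [x] is orthogonal over 'F_2 to every edge
   vector, because no edge leaves the component. *)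
Lemma edge_span_connect U F x y : F \subset complete_edges U ->
  vertex_vec x + vertex_vec y \in edge_span F -> connect (adj F) x y.
Proof.
move=> /fintype.subsetP FU /edge_spanP[k kE].
have [-> //|xy] := eqVneq x y.
apply/negPn/negP => ncxy.
have /(congr1 (fun u : {ffun V -> ('F_2)^o} => \sum_(z | connect (adj F) x z) u z)) := kE.
have -> : \sum_(z | connect (adj F) x z) (vertex_vec x + vertex_vec y) z = 1.
  rewrite (bigD1 x) ?connect0 //= !ffunE eqxx (negbTE xy) addr0 big1 ?addr0 //.
  move=> z /andP[xz zx]; rewrite !ffunE (negbTE zx) add0r.
  by have [zy|//] := eqVneq z y; rewrite -zy xz in ncxy.
under eq_bigr do rewrite sum_ffunE.
rewrite exchange_big /= big1 => [/eqP|e eF]; first by rewrite oner_eq0.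
have /cards2P[a [b [ab eE]]] : #|e| == 2%N by move: (FU _ eF); rewrite inE => /andP[].
have cab : connect (adj F) x a = connect (adj F) x b.
  have symF := sym_connect_sym (adj_sym F).
  rewrite !(symF x); apply: same_connect => //; apply: connect1.
  by rewrite /adj ab -eE.
have kE' z : (k e *: edge_vec e) z =
    k e *: ((z == a)%:R : ('F_2)^o) + k e *: ((z == b)%:R : ('F_2)^o).
  by rewrite {2}eE edge_vec_set2 // !ffunE scalerDr.
rewrite (eq_bigr _ (fun z _ => kE' z)) big_split /=.
have pick c : \sum_(z | connect (adj F) x z) k e *: ((z == c)%:R : ('F_2)^o) =
    if connect (adj F) x c then k e *: (1 : ('F_2)^o) else 0.
  case: ifP => xc.
    rewrite (bigD1 c) //= eqxx big1 ?addr0 // => z /andP[_ /negbTE ->].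
    by rewrite scaler0.
  rewrite big1 // => z xz; case: eqP => [zc|_]; last by rewrite scaler0.
  by rewrite -zc xz in xc.
rewrite !pick -cab; case: ifP => _; last by rewrite addr0.
by rewrite -scalerDr (_ : 1 + 1 = 0 :> 'F_2) ?scaler0 //; apply: val_inj.
Qed.

Lemma connected_on_edge_span U F : connected_on U F ->
  (edge_span (complete_edges U) <= edge_span F)%VS.
Proof.
move=> FU; apply: edge_span_sub => e; rewrite inE => /andP[eU /cards2P[x [y [xy eE]]]].
rewrite eE edge_vec_set2 //; apply/connect_edge_span/FU.
  by apply: (fintype.subsetP eU); rewrite eE finset.set21.
by apply: (fintype.subsetP eU); rewrite eE finset.set22.
Qed.

(* A cycle would put one of its edges in the span of the others. *)
Lemma edge_rank_acyclic F : edge_rank F = #|F| -> acyclic F.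
Proof.
move=> rkF [|x [|y [|z c]]] // /andP[/= /and3P[xyF yz zc] uniq_c].
set e := [set x; y]%SET; have /andP[xy eF] := xyF.
suff : edge_vec e \in edge_span (F :\ e).
  move=> espan; have : (edge_rank F <= #|F :\ e|)%N.
    rewrite -{1}(finset.setD1K eF) /edge_rank edge_span_setU1.
    by rewrite (addv_idPr _) -?memvE //; apply: edge_rank_card.
  by rewrite rkF (cardsD1 e F) eF add1n ltnn.
have adjD a b : adj F a b -> ([set a; b]%SET != e) -> adj (F :\ e) a b.
  by move=> /andP[ab abF] abe; rewrite /adj ab !inE abe.
rewrite edge_vec_set2 // addrC; apply: connect_edge_span.
move: uniq_c; rewrite !inE !negb_or => /and4P[/and3P[_ xz xc] /andP[yz' yc] zc' uc].
(* The rest of the cycle leads from [y] over [z] back to [x]: the edge [yz] misses [x] and all later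
   edges miss [y], so none of them is [e]. *)
apply: (@connect_trans _ _ z).
  apply/connect1/adjD => //; apply/eqP/setP => /(_ x).
  by rewrite !inE eqxx /= (negbTE xy) (negbTE xz).
apply/connectP; exists (rcons c x); last by rewrite last_rcons.
have yNc : y \notin z :: c by rewrite inE negb_or yz'.
elim: c z {yz xz yz' zc' uc xc yc} zc yNc => [|t c IHc] z /=.
  rewrite !inE andbT => zx yz; rewrite andbT; apply: adjD => //.
  apply/eqP/setP => /(_ y); rewrite !inE eqxx orbT (negbTE yz) /=.
  by rewrite eq_sym (negbTE xy).
move=> /andP[zt tc]; rewrite !inE !negb_or => /and3P[yz yt yc].
rewrite IHc ?inE ?negb_or ?yt // andbT; apply: adjD => //.
apply/eqP/setP => /(_ y); rewrite !inE eqxx orbT (negbTE yz) /=.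
by rewrite (negbTE yt).
Qed.

(** Spanning gives connectedness by [edge_span_connect], independence gives acyclicity by
    [edge_rank_acyclic]. *)
Lemma edge_rank_max_spanning_tree U F : F \subset complete_edges U ->
  (edge_span (complete_edges U) <= edge_span F)%VS ->
  edge_rank F = #|F| -> spanning_tree U F.
Proof.
move=> FU spanF rkF; split => //; last exact: edge_rank_acyclic.
move=> x y xU yU; apply: (edge_span_connect FU).
have [->|xy] := eqVneq x y; first by rewrite F2_addv_self mem0v.
apply: (subvP spanF); rewrite -edge_vec_set2 //; apply: edge_vec_in_span.
by rewrite inE cards2 xy eqxx andbT; apply/fintype.subsetP => z; rewrite !inE => /orP[]/eqP->.
Qed.

(** * Kruskal's tree and the number of heavy edges *)

Section Greedy.
Variables (R : realDomainType) (w : {set V} -> R).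

(* Kruskal's algorithm: a heaviest edge is processed last. *)
Lemma greedy_basis F : exists2 B : {set {set V}}, B \subset F &
  [/\ (edge_span F <= edge_span B)%VS, edge_rank F = #|B| &
  forall g, edge_rank [set e in F | w e < g]%SET = #|[set e in B | w e < g]%SET|].
Proof.
have [m] := ubnP #|F|; elim: m F => // m IHm F.
have [->|/finset.set0Pn[e0 e0F]] := eqVneq F finset.set0.
  have rk0 : edge_rank (finset.set0 : {set {set V}}) = 0%N.
    by rewrite /edge_rank /edge_span big_set0 dimv0.
  move=> _; exists finset.set0 => //; split=> // [|g]; first by rewrite cards0.
  have -> : [set e in finset.set0 | w e < g]%SET = finset.set0 :> {set {set V}}.
    by apply/setP => e; rewrite !inE.
  by rewrite cards0.
case: (arg_maxP w e0F) => /= e inF emax Fm; have eF : e \in F := inF.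
have [|B BF [spanB sizeB cardB]] := IHm (F :\ e).
  by rewrite -ltnS (leq_trans _ Fm) // ltnS [leqRHS](cardsD1 e) eF.
have BsF : B \subset F by apply: fintype.subset_trans BF (finset.subD1set _ _).
(* A threshold at or below the weight of [e] does not see [e], and induction applies; above it all
   of [F] counts, as [e] is heaviest, and only the full rank matters. *)
have ltF g : ~~ (w e < g) -> [set a in F | w a < g]%SET = [set a in F :\ e | w a < g]%SET.
  move=> weg; apply/setP => a; rewrite !inE; case: (eqVneq a e) => [->|//].
  by rewrite (negbTE weg) !andbF.
have allF F' g : F' \subset F -> w e < g -> [set a in F' | w a < g]%SET = F'.
  move=> /fintype.subsetP sF' weg; apply/setP => a; rewrite !inE.
  case: (boolP (a \in F')) => //= /sF' aF.
  by apply: le_lt_trans weg; apply: emax.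
have [e_dep|e_indep] := boolP (edge_vec e \in edge_span (F :\ e)).
  have spanFe : edge_span F = edge_span (F :\ e).
    by rewrite -{1}(finset.setD1K eF) edge_span_setU1 (addv_idPr _) // -memvE.
  exists B => //; split=> [||g]; first by rewrite spanFe.
    by rewrite /edge_rank spanFe.
  have [weg|weg] := boolP (w e < g); last by rewrite ltF.
  by rewrite -cardB !allF ?finset.subD1set // /edge_rank spanFe.
exists (e |: B).
  apply/fintype.subsetP => a; rewrite !inE => /orP[/eqP->//|].
  exact: fintype.subsetP.
have eB : e \notin B by apply/negP => /(fintype.subsetP BF); rewrite !inE eqxx.
have sizeeB : edge_rank F = #|e |: B|.
  by rewrite cardsU1 eB -sizeB -{1}(finset.setD1K eF) edge_rank_setU1.
split=> // [|g].
  rewrite -{1}(finset.setD1K eF) !edge_span_setU1; exact: addvS.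
have [weg|weg] := boolP (w e < g); last first.
  rewrite ltF // cardB; apply: eq_card => a; rewrite !inE.
  by case: (eqVneq a e) => [->|//]; rewrite (negbTE weg) !andbF.
rewrite !allF //; apply/fintype.subsetP => a; rewrite !inE => /orP[/eqP->//|].
exact: fintype.subsetP.
Qed.

(** [F] has full rank, its light edges lie among those of the complete graph, and each heavy edge
    adds at most one to the rank. This bounds the heavy edges of any spanning tree from below. *)
Lemma connected_heavy_edges U F g : F \subset complete_edges U ->
  connected_on U F ->
  (edge_rank (complete_edges U) <=
     edge_rank [set e in complete_edges U | (w e < g)%R]%SET
     + #|[set e in F | (g <= w e)%R]%SET|)%N.
Proof.
move=> FU /connected_on_edge_span/dimvS rkF.
apply: leq_trans rkF _; apply: leq_trans (edge_rank_setU _ _).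
apply: edge_rankS; apply/fintype.subsetP => e eF.
by rewrite !inE eF; have := fintype.subsetP FU _ eF; rewrite inE => ->; case: ltP.
Qed.

End Greedy.

End EdgeSpace.

(** * Saving games of threshold graphs *)

Section LevelGames.
Variables (R : realType) (n : nat) (w : {set node n} -> R).
Implicit Types (S : {set 'I_n}) (T : {set {set node n}}) (g : R) (i j : 'I_n).

Definition root_edge i : {set node n} := [set None; Some i]%SET.

Definition light_edges g S : {set {set node n}} :=
  [set e in complete_edges (with_root S) | w e < g]%SET.

(** A minimum spanning tree of the 0-1 weighting costs [#|S| - level_rank g S]; in the saving game
    the terms [#|S|] cancel. *)
Definition level_rank g S : nat := edge_rank (light_edges g S).

(* The saving game of the 0-1 weighting "w e >= g". *)
Definition level_game g S : R :=
  (level_rank g S)%:R - #|[set i in S | w (root_edge i) < g]%SET|%:R.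

Lemma mem_with_root_Some S i : (Some i \in with_root S) = (i \in S).
Proof. by rewrite !inE /= mem_imset //; exact: Some_inj. Qed.

Lemma mem_with_root_None S : None \in with_root S.
Proof. by rewrite !inE. Qed.

Lemma edge_set2 S (x y : node n) : x != y -> x \in with_root S ->
  y \in with_root S -> [set x; y]%SET \in complete_edges (with_root S).
Proof.
move=> xy xS yS; rewrite inE cards2 xy eqxx andbT.
by apply/fintype.subsetP => z; rewrite !finset.in_set2 => /orP[]/eqP->.
Qed.

Lemma root_edge_complete S i : i \in S ->
  root_edge i \in complete_edges (with_root S).
Proof. by move=> iS; rewrite edge_set2 ?mem_with_root_Some ?mem_with_root_None. Qed.

Lemma with_rootS S S' : S \subset S' -> with_root S \subset with_root S'.
Proof. by move=> SS'; apply/finset.setUS/imsetS. Qed.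

Lemma complete_edgesS (U U' : {set node n}) : U \subset U' ->
  complete_edges U \subset complete_edges U'.
Proof.
move=> UU'; apply/fintype.subsetP => e; rewrite !inE => /andP[eU ->].
by rewrite (fintype.subset_trans eU).
Qed.

Lemma light_edgesS g S S' : S \subset S' -> light_edges g S \subset light_edges g S'.
Proof.
move=> /with_rootS/complete_edgesS/fintype.subsetP SS'.
apply/fintype.subsetP => e; rewrite finset.in_set => /andP[/SS' eS weg].
by rewrite finset.in_set eS.
Qed.

Lemma light_edges_sub g S : light_edges g S \subset complete_edges (with_root S).
Proof. by apply/fintype.subsetP => e; rewrite inE => /andP[]. Qed.

(** The star is connected, so it has the same span; its edges are independent because each one
    reaches a fresh vertex. *)
Lemma edge_rank_complete S : edge_rank (complete_edges (with_root S)) = #|S|.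
Proof.
have [starK starC _] := star_spanning S.
have -> : edge_rank (complete_edges (with_root S)) = edge_rank (star S).
  apply/eqP; rewrite eqn_leq (edge_rankS starK) andbT.
  exact/dimvS/connected_on_edge_span.
have [m] := ubnP #|S|; elim: m S {starK starC} => // m IHm S.
have [->|/finset.set0Pn[i iS]] := eqVneq S finset.set0.
  by rewrite /star imset0 cards0 /edge_rank /edge_span big_set0 dimv0.
rewrite (cardsD1 i) iS ltnS => Sm.
rewrite -{1}(finset.setD1K iS) /star imsetU1 -/(star (S :\ i)) edge_rank_setU1 ?IHm //.
have [starK _ _] := star_spanning (S :\ i).
apply: (@edge_span_notin _ _ _ (Some i) _ starK); rewrite ?finset.set22 //.
by rewrite mem_with_root_Some !inE eqxx.
Qed.

Lemma complete_edges_setU1 S i e :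
  e \in complete_edges (with_root (i |: S)%SET) ->
  e \in complete_edges (with_root S) \/
  exists2 x, x \in with_root S & e = [set x; Some i]%SET.
Proof.
rewrite inE => /andP[/fintype.subsetP eS e2].
have eS' x : x \in e -> x != Some i -> x \in with_root S.
  case: x => [j|] /eS; last by rewrite !mem_with_root_None.
  by rewrite !mem_with_root_Some inE => /orP[/set1P->|//]; rewrite eqxx.
have [ie|ie] := boolP (Some i \in e); last first.
  left; rewrite inE e2 andbT; apply/fintype.subsetP => x xe.
  by apply: eS' => //; apply: contraNneq ie => <-.
right; have /cards2P[x [y [xy eE]]] := e2.
move: ie; rewrite eE !inE => /orP[]/eqP iE.
  exists y; last by rewrite iE finset.setUC.
  by apply: eS'; rewrite ?iE 1?eq_sym // eE finset.set22.
exists x; last by rewrite iE.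
by apply: eS'; rewrite ?iE // eE finset.set21.
Qed.

Lemma edge_vec_new S i x g : i \notin S ->
  edge_vec [set x; Some i]%SET \notin edge_span (light_edges g S).
Proof.
move=> iS; apply: (edge_span_notin (light_edges_sub g S) (x := Some i)).
  by rewrite mem_with_root_Some.
exact: finset.set22.
Qed.

(** A light root edge of [i] raises the rank by one, since [Some i] is a fresh vertex. Marginals are
    therefore nonnegative. *)
Lemma level_rank_ge g S i : i \notin S ->
  (level_rank g S + (w (root_edge i) < g)%R <= level_rank g (i |: S)%SET)%N.
Proof.
move=> iS; have sub := light_edgesS g (finset.subsetUr [set i]%SET S).
have [wig|wig] := boolP (w (root_edge i) < g); last by rewrite addn0 edge_rankS.
rewrite addn1 -(edge_rank_setU1 (edge_vec_new None g iS)); apply: edge_rankS.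
apply/fintype.subsetP => e; rewrite finset.in_setU1 => /orP[/eqP->|].
  by rewrite finset.in_set root_edge_complete ?wig // finset.setU11.
exact: fintype.subsetP.
Qed.

(** All new light edges end at [i]: the root edge ([F0]) and edges to players of [S] ([F1]). Each
    adds at most one to the rank. *)
Lemma level_rank_le g S i :
  (level_rank g (i |: S)%SET <=
     level_rank g S + (w (root_edge i) < g)%R +
     #|[set j in S | (w [set Some j; Some i]%SET < g)%R]%SET|)%N.
Proof.
pose F0 := if (w (root_edge i) < g)%R then [set root_edge i]%SET else finset.set0.
pose F1 := [set [set Some j; Some i]%SET | j in
   [set j in S | w [set Some j; Some i]%SET < g]%SET]%SET.
apply: (@leq_trans (edge_rank ((light_edges g S :|: F0) :|: F1))).
  apply: edge_rankS; apply/fintype.subsetP => e; rewrite inE => /andP[].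
  move=> /complete_edges_setU1[eS|[[j|] jS ->]] weg; rewrite !finset.in_setU.
  - by rewrite finset.in_set eS weg.
  - apply/orP; right; apply/imsetP; exists j => //.
    by rewrite finset.in_set weg andbT -mem_with_root_Some.
  - by rewrite /F0 /root_edge weg finset.set11 orbT.
apply: leq_trans (edge_rank_setU _ _) _; apply: leq_add (leq_imset_card _ _).
apply: leq_trans (edge_rank_setU _ _) _; rewrite leq_add2l /F0.
by case: ifP => _; rewrite ?cards1 ?cards0.
Qed.

Lemma level_marginalE g S i : i \notin S ->
  level_game g (i |: S)%SET - level_game g S =
  (level_rank g (i |: S)%SET)%:R - (level_rank g S + (w (root_edge i) < g)%R)%N%:R.
Proof.
move=> iS; rewrite /level_game.
have -> : #|[set j in (i |: S) | w (root_edge j) < g]%SET| =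
    ((w (root_edge i) < g)%R + #|[set j in S | (w (root_edge j) < g)%R]%SET|)%N.
  have [wig|wig] := boolP (w (root_edge i) < g).
    transitivity #|i |: [set j in S | w (root_edge j) < g]%SET|.
      apply: eq_card => j; rewrite !inE.
      by case: (eqVneq j i) => [->|//]; rewrite wig.
    by rewrite cardsU1 !inE negb_and iS.
  apply: eq_card => j; rewrite !inE.
  by case: (eqVneq j i) => [->|//]; rewrite (negbTE wig) !andbF.
by rewrite !natrD; ring.
Qed.

Lemma level_marginal_ge0 g S i : i \notin S ->
  0 <= level_game g (i |: S)%SET - level_game g S.
Proof. by move=> iS; rewrite level_marginalE // subr_ge0 ler_nat level_rank_ge. Qed.

Lemma level_marginal_le g S i : i \notin S ->
  level_game g (i |: S)%SET - level_game g S <= #|S|%:R.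
Proof.
move=> iS; rewrite level_marginalE // lerBlDl -natrD ler_nat.
apply: leq_trans (level_rank_le _ _ _) _; rewrite leq_add2l.
by apply/subset_leq_card/fintype.subsetP => j; rewrite inE => /andP[].
Qed.

(* A player who ever brings a saving already does so when joining some single
   player [j]: one linked to [i] by a light edge which, when the edge from [i]
   to the root is light, is not itself linked to the root by a light edge. *)
Lemma level_marginal_pair g S i : i \notin S ->
  level_game g (i |: S)%SET != level_game g S ->
  exists2 j, j != i &
    1 <= level_game g (i |: [set j])%SET - level_game g [set j]%SET.
Proof.
move=> iS; rewrite -subr_eq0 level_marginalE // => marg.
have [j jS [wji wj]] : exists2 j, j \in S & w [set Some j; Some i]%SET < g /\
    ~~ ((w (root_edge i) < g) && (w (root_edge j) < g)).
  apply: contrapT => noj; move/eqP: marg; apply.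
  apply/eqP; rewrite subr_eq0 eqr_nat eqn_leq level_rank_ge // andbT.
  (* Suppose there is no such [j]. If the root edge of [i] is heavy, no light edge joins [i] to [S].
     If it is light, every light edge [ji] closes a triangle with two light root edges and lies in
     their span. *)
  have [wig|wig] := boolP (w (root_edge i) < g); last first.
    apply: leq_trans (level_rank_le _ _ _) _.
    rewrite (negbTE wig) [X in (_ + X)%N](_ : _ = 0%N) ?addn0 //.
    apply/eqP; rewrite cards_eq0; apply/eqP/setP => j; rewrite !inE.
    apply/negP => /andP[jS wji]; apply: noj; exists j => //.
    by rewrite (negbTE wig).
  rewrite addn1 -(edge_rank_setU1 (edge_vec_new None g iS)).
  apply/dimvS/edge_span_sub => e; rewrite inE => /andP[].
  have spanU : {subset light_edges g S <= root_edge i |: light_edges g S}.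
    by move=> a aS; rewrite finset.setU1r.
  move=> /complete_edges_setU1[eS|[[j|] jS ->]] weg.
  - by apply/edge_vec_in_span/spanU; rewrite finset.in_set eS.
  - have ji : Some j != Some i.
      by apply: contraNneq iS => -[<-]; rewrite -mem_with_root_Some.
    rewrite mem_with_root_Some in jS.
    have wj : w (root_edge j) < g.
      apply: contrapT => /negP wj; apply: noj; exists j => //.
      by rewrite weg (negbTE wj) andbF.
    have -> : edge_vec [set Some j; Some i]%SET =
        edge_vec (root_edge j) + edge_vec (root_edge i).
      rewrite !edge_vec_set2 // addrAC addrA F2_addv_self add0r.
      exact: addrC.
    apply: memvD; apply: edge_vec_in_span; last exact: finset.setU11.
    by apply: spanU; rewrite finset.in_set wj root_edge_complete.
  - by apply: edge_vec_in_span; exact: finset.setU11.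
have ji : j != i by apply: contraNneq iS => <-.
have iNj : i \notin [set j]%SET by rewrite inE eq_sym.
exists j => //; rewrite level_marginalE // lerBrDr nat1r ler_nat.
have jiin : [set Some j; Some i]%SET \in light_edges g (i |: [set j])%SET.
  by rewrite finset.in_set wji andbT edge_set2 ?mem_with_root_Some // !inE eqxx ?orbT.
have [wig|wig] := boolP (w (root_edge i) < g); last first.
  rewrite addn0 -(edge_rank_setU1 (edge_vec_new (Some j) g iNj)).
  apply: edge_rankS; apply/fintype.subsetP => e; rewrite finset.in_setU1.
  move=> /orP[/eqP->//|]; apply: fintype.subsetP e.
  exact/light_edgesS/finset.subsetUr.
(* Here the root edge of [j] is heavy, so [j] alone has rank 0, while [ji] and the root edge of [i]
   are two independent light edges of the pair. *)
have -> : level_rank g [set j]%SET = 0%N.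
  rewrite /level_rank (_ : light_edges _ _ = finset.set0); last first.
    apply/setP => e; rewrite inE finset.in_set0 -(finset.setU0 [set j]%SET).
    apply/negP => /andP[/complete_edges_setU1[|[[k|] k0 ->]]].
    - rewrite inE /with_root imset0 finset.setU0 => /andP[/subset_leq_card le1 /eqP e2] _.
      by rewrite e2 cards1 in le1.
    - by rewrite mem_with_root_Some inE in k0.
    - by move=> wj0; move: wj; rewrite wig /root_edge wj0.
  by rewrite /edge_rank /edge_span big_set0 dimv0.
have ri : root_edge i \in light_edges g (i |: [set j])%SET.
  by rewrite finset.in_set wig andbT root_edge_complete // finset.setU11.
rewrite add0n; apply: (@leq_trans (edge_rank [set [set Some j; Some i]%SET; root_edge i]%SET)).
  rewrite edge_rank_setU1; last first.
    apply: (@edge_span_notin _ (root_edge i) _ (Some j)); last exact: finset.set21.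
      by apply/fintype.subsetP => e /set1P ->; rewrite inE cards2 fintype.subxx.
    by rewrite !inE /= (inj_eq Some_inj).
  rewrite ltnS /edge_rank /edge_span big_set1 dim_vline.
  by case: eqP => // /ffunP/(_ None); rewrite !ffunE !inE.
by apply: edge_rankS; apply/fintype.subsetP => e; rewrite finset.in_set2 => /orP[]/eqP->.
Qed.

End LevelGames.

(** * Layer decomposition of the saving game *)

Section Layers.
Variable R : realDomainType.

(** The gaps below the thresholds not exceeding [x] telescope from [a] up to [x]. *)
Lemma layer_cake (a x : R) (s : seq R) : path <%R a s -> x \in a :: s ->
  x = a + \sum_(h < size s) (s`_h - (a :: s)`_h) * (s`_h <= x)%R%:R.
Proof.
elim: s a => [|b s IHs] a /=; first by rewrite big_ord0 addr0 inE => _ /eqP.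
move=> /andP[ab bs]; rewrite inE => /orP[/eqP->|xs].
  rewrite big1 ?addr0 // => h _; rewrite leNgt (_ : a < _) ?mulr0 //.
  have abs : path <%R a (b :: s) by rewrite /= ab.
  by apply: (allP (order_path_min lt_trans abs)); apply: mem_nth.
have bx : b <= x.
  move: xs; rewrite inE => /orP[/eqP->//|xs].
  by apply/ltW; move: bs => /(order_path_min lt_trans)/allP; exact.
rewrite big_ord_recl /= bx mulr1 addrA (addrC a) subrK; exact: IHs.
Qed.

End Layers.

Section SavingDecomposition.
Variables (R : realType) (n : nat) (w : {set node n} -> R).
Hypothesis w_ge0 : forall e, e \in complete_edges [set: node n]%SET -> 0 <= w e.
Implicit Types (S : {set 'I_n}) (T : {set {set node n}}) (g : R) (i j : 'I_n).

Definition levels : seq R := sort <=%R (undup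
  [seq w e | e <- enum (complete_edges [set: node n]%SET) & 0 < w e]).

(** Indexing from 0, entry [h] of [levels] is g_(h+1); the 0 put in front supplies the preceding
    threshold, so this is g_(h+1) - g_h. *)
Definition level_gap (h : nat) : R := levels`_h - (0 :: levels)`_h.

Lemma size_levels : size levels = num_pos_weights w.
Proof. by rewrite size_sort. Qed.

Lemma levels_path : path <%R 0 levels.
Proof.
rewrite path_min_sorted.
  by rewrite lt_sorted_uniq_le sort_uniq undup_uniq sort_le_sorted.
apply/allP => x; rewrite mem_sort mem_undup => /mapP[e].
by rewrite mem_filter => /andP[we _] ->.
Qed.

Lemma level_gap_gt0 h : (h < num_pos_weights w)%N -> 0 < level_gap h.
Proof.
rewrite -size_levels => hlt; rewrite subr_gt0.
exact: (pathP 0 levels_path).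
Qed.

Lemma weight_layers e : e \in complete_edges [set: node n]%SET ->
  w e = \sum_(h < num_pos_weights w) level_gap h * (levels`_h <= w e)%R%:R.
Proof.
move=> eC; rewrite {1}(layer_cake levels_path (_ : w e \in 0 :: levels)).
  by rewrite add0r -size_levels.
rewrite inE; have [//|we0] := eqVneq (w e) 0.
rewrite mem_sort mem_undup; apply: map_f.
by rewrite mem_filter mem_enum eC lt_def we0 w_ge0.
Qed.

Lemma edge_set_weight_layers T : T \subset complete_edges [set: node n]%SET ->
  edge_set_weight w T =
  \sum_(h < num_pos_weights w)
     level_gap h * #|[set e in T | levels`_h <= w e]%SET|%:R.
Proof.
move=> /fintype.subsetP TC; rewrite /edge_set_weight.
under eq_bigr => e /TC eC do rewrite weight_layers //.
rewrite exchange_big; apply: eq_bigr => h _; rewrite -mulr_sumr; congr (_ * _).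
rewrite -sum1_card natr_sum big_mkcond [RHS]big_mkcond; apply: eq_bigr => e _.
by rewrite inE; case: (e \in T) => //=; case: (_ <= _).
Qed.

Lemma heavy_light_card T g :
  (#|[set e in T | (g <= w e)%R]%SET| + #|[set e in T | (w e < g)%R]%SET| = #|T|)%N.
Proof.
rewrite -(cardsID [set e | (g <= w e)%R]%SET T); congr (_ + _)%N.
  by apply: eq_card => e; rewrite !inE.
by apply: eq_card => e; rewrite !inE -ltNge andbC.
Qed.

(** At each threshold every spanning tree has at least [#|S|] minus the light rank heavy edges; the
    greedy tree attains equality at all thresholds at once. *)
Lemma mcst_cost_layers S : mcst_cost w S =
  \sum_(h < num_pos_weights w)
     level_gap h * (#|S|%:R - (level_rank w levels`_h S)%:R).
Proof.
have [[T tT cE] cmin] := mcst_cost_min w S.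
have KT : complete_edges (with_root S) \subset complete_edges [set: node n]%SET.
  exact/complete_edgesS/finset.subsetT.
apply/eqP; rewrite eq_le; apply/andP; split; last first.
  have [TK Tconn _] := tT.
  rewrite cE edge_set_weight_layers ?(fintype.subset_trans TK) //.
  apply: ler_sum => h _; apply: ler_wpM2l; first exact/ltW/level_gap_gt0.
  rewrite lerBlDl -natrD ler_nat -edge_rank_complete.
  exact: connected_heavy_edges.
have [B BK [spanB sizeB cardB]] := greedy_basis w (complete_edges (with_root S)).
have rkB : edge_rank B = #|B|.
  apply/eqP; rewrite eqn_leq edge_rank_card -sizeB; exact: dimvS.
apply: (le_trans (cmin B _)); first exact: edge_rank_max_spanning_tree.
rewrite edge_set_weight_layers ?(fintype.subset_trans BK) //.
apply: ler_sum => h _; apply: ler_wpM2l; first exact/ltW/level_gap_gt0.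
rewrite lerBrDr -natrD ler_nat -edge_rank_complete sizeB /level_rank cardB.
by rewrite heavy_light_card.
Qed.

Lemma level_rank_set1 g i : level_rank w g [set i]%SET = (w (root_edge i) < g)%R.
Proof.
have i0 : i \notin (finset.set0 : {set 'I_n}) by rewrite inE.
have := level_rank_le w g finset.set0 i; have := level_rank_ge w g i0.
rewrite finset.setU0 (_ : level_rank w g finset.set0 = 0%N).
  rewrite add0n [X in (_ + X)%N](_ : _ = 0%N) ?addn0.
    by move=> le1 le2; apply/eqP; rewrite eqn_leq le1 le2.
  by apply/eqP; rewrite cards_eq0; apply/eqP/setP => j; rewrite !inE.
apply/eqP; rewrite -leqn0 -(cards0 'I_n) -edge_rank_complete.
exact/edge_rankS/light_edges_sub.
Qed.

Lemma mcst_saving_layers S : mcst_saving w S =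
  \sum_(h < num_pos_weights w) level_gap h * level_game w levels`_h S.
Proof.
rewrite /mcst_saving mcst_cost_layers.
under eq_bigr do rewrite mcst_cost_layers.
rewrite exchange_big -sumrB; apply: eq_bigr => h _.
rewrite -mulr_sumr -mulrBr; congr (_ * _).
under eq_bigr do rewrite cards1 level_rank_set1.
rewrite sumrB sumr_const /level_game.
have -> : \sum_(i in S) ((w (root_edge i) < levels`_h)%R : nat)%:R =
    #|[set i in S | w (root_edge i) < levels`_h]%SET|%:R :> R.
  rewrite -sum1_card natr_sum [LHS]big_mkcond [RHS]big_mkcond; apply: eq_bigr => i _.
  by rewrite inE; case: (i \in S) => //=; case: (_ < _).
by ring.
Qed.

End SavingDecomposition.

(** * Hoeffding's inequality for finite uniform samples *)

Section Hoeffding.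
Variable R : realType.
Implicit Types (p s t b lam : R) (f df : R -> R).

Lemma derive_ge0_ge_at0 f df s : (forall x, is_derive x (1 : R) f (df x)) ->
  (forall x, 0 <= x -> 0 <= df x) -> 0 <= s -> f 0 <= f s.
Proof.
move=> fdf df0 s0.
have [|c] := MVT_segment s0 (fun x _ => fdf x).
  by apply: derivable_within_continuous => x _; apply: ex_derive.
rewrite in_itv /= => /andP[c0 _]; rewrite subr0 -subr_ge0 => ->.
by rewrite mulr_ge0 // df0.
Qed.

Lemma is_derive_bernoulli_mgf p s :
  is_derive s (1 : R) (fun x => 1 - p + p * expR x) (p * expR s).
Proof.
have -> : (fun x => 1 - p + p * expR x) = cst (1 - p) + p *: (expR : R -> R).
  by apply/funext => x.
have := is_deriveD (is_derive_cst (1 - p) s 1) (is_deriveZ p (is_derive_expR s)).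
by rewrite add0r.
Qed.

Lemma bernoulli_mgf_gt0 p s : 0 <= p <= 1 -> 0 < 1 - p + p * expR s.
Proof.
move=> /andP[p0 p1]; have := expR_gt0 s.
move: p0; rewrite le_eqVlt => /orP[/eqP<-|p0] es; first by rewrite mul0r; lra.
by have := mulr_gt0 p0 es; lra.
Qed.

(* The logarithm of the left-hand side agrees with [s * p] to first order at 0,
   and its second derivative has the form q(1 - q), hence is at most 1/4. *)
Lemma bernoulli_mgf_le p s : 0 <= p <= 1 -> 0 <= s ->
  1 - p + p * expR s <= expR (s * p + s ^+ 2 / 8).
Proof.
move=> p01 s0; have D_gt0 x := bernoulli_mgf_gt0 x p01.
pose D x := 1 - p + p * expR x.
(* [F1] is the derivative of [F] below, with p e^x / D written as 1 - (1 - p) / D. *)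
pose F1 x := x / 4 + p - 1 + (1 - p) / D x.
have dF1 x : is_derive x (1 : R) F1 (4^-1 - (1 - p) * p * expR x / (D x) ^+ 2).
  have -> : F1 = (4^-1 : R) *: (id : R -> R) + cst (p - 1) + (1 - p) *: (fun x => (D x)^-1).
    by apply/funext => y; rewrite /F1 /= !fctE /= /GRing.scale /=; lra.
  have dD := is_derive_bernoulli_mgf p x.
  have dV : is_derive x (1 : R) (fun y => (D y)^-1) (- (D x) ^- 2 *: (p * expR x)).
    by apply: is_deriveV => //; rewrite gt_eqF // D_gt0.
  apply: (is_derive_eq (is_deriveD (is_deriveD (is_deriveZ _ (is_derive_id x 1))
    (is_derive_cst _ x 1)) (is_deriveZ _ dV))); rewrite /GRing.scale /=; field.
  by rewrite gt_eqF // D_gt0.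
have F1_ge0 x : 0 <= x -> 0 <= F1 x.
  move=> x0; have F10 : F1 0 = 0.
    by rewrite /F1 /D expR0 mulr1 subrK divr1; lra.
  rewrite -F10; apply: (derive_ge0_ge_at0 dF1 _ x0) => y _.
  rewrite subr_ge0 ler_pdivrMr ?exprn_gt0 ?D_gt0 //.
  (* A nonnegative square gives 4 (1 - p) p e <= (1 - p + p e)^2, which is q (1 - q) <= 1/4 for q =
     p e / D. *)
  rewrite /D; set e := expR y; have := sqr_ge0 (1 - p - p * e); nra.
pose F x := x ^+ 2 / 8 + x * p - ln (D x).
have dF x : is_derive x (1 : R) F (F1 x).
  have -> : F = (8^-1 : R) *: ((id : R -> R) ^+ 2) + p *: (id : R -> R) - (@ln R \o D).
    by apply/funext => y; rewrite /F /= !fctE /= /GRing.scale /=; lra.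
  have dD := is_derive_bernoulli_mgf p x.
  have dl : is_derive x (1 : R) (@ln R \o D) ((D x)^-1 * (p * expR x)).
    by apply: is_derive1_comp; apply: is_derive1_ln; exact: D_gt0.
  apply: (is_derive_eq (is_deriveB (is_deriveD (is_deriveZ _ (is_deriveX 2 (is_derive_id x 1)))
    (is_deriveZ _ (is_derive_id x 1))) dl)); rewrite /F1 /D /GRing.scale /=; field.
  by rewrite gt_eqF // D_gt0.
have : F 0 <= F s by exact: (derive_ge0_ge_at0 dF F1_ge0 s0).
rewrite /F /D expR0 mulr1 subrK ln1 expr0n /= !mul0r addr0 subr0 subr_ge0.
by move=> lnD; rewrite -ler_ln ?posrE ?expR_gt0 // expRK [leRHS]addrC.
Qed.

(** Convexity, with [x] the mixture of [b] and 0 with weights [x / b] and [1 - x / b]. It compares a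
    bounded variable with a Bernoulli one. *)
Lemma expR_chord_le s b x : 0 < b -> 0 <= x <= b ->
  expR (s * x) <= 1 - x / b + x / b * expR (s * b).
Proof.
move=> b0 /andP[x0 xb].
have t0 : 0 <= x / b by rewrite divr_ge0 // ltW.
have t1 : x / b <= 1 by rewrite ler_pdivrMr // mul1r.
have := convex_expR (Itv01 t0 t1) (s * b) 0.
rewrite !convRE /= expR0 mulr0 addr0 mulr1.
rewrite (_ : x / b * (s * b) = s * x); first by rewrite addrC.
by field; rewrite gt_eqF.
Qed.

(** * Exponential moments and tail counts of finite samples *)

Section FiniteSample.
Variables (T : finType) (f : T -> R) (b : R).
Hypotheses (T_gt0 : (0 < #|T|)%N) (b_gt0 : 0 < b) (f_itv : forall s : T, 0 <= f s <= b).

Let mean := #|T|%:R^-1 * \sum_(s : T) f s.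

(** Hoeffding's lemma, multiplied by [#|T|]: summing the chord bound leaves a Bernoulli variable
    with parameter [mean / b] and argument [lam * b]. *)
Lemma mgf_le lam : 0 <= lam ->
  \sum_(s : T) expR (lam * (f s - mean)) <= #|T|%:R * expR (lam ^+ 2 * b ^+ 2 / 8).
Proof.
move=> lam0; have cT : 0 < #|T|%:R :> R by rewrite ltr0n.
pose p := mean / b.
have sumf : \sum_(s : T) f s = #|T|%:R * mean by rewrite /mean mulrA mulfV ?mul1r ?gt_eqF.
have p01 : 0 <= p <= 1.
  have f0 : 0 <= \sum_(s : T) f s by apply: sumr_ge0 => s _; have /andP[] := f_itv s.
  have fb : \sum_(s : T) f s <= #|T|%:R * b.
    rewrite mulr_natl -sumr_const; apply: ler_sum => s _.
    by have /andP[] := f_itv s.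
  rewrite /p ler_pdivlMr // mul0r ler_pdivrMr // mul1r.
  by rewrite sumf pmulr_rge0 // in f0; rewrite sumf ler_pM2l // in fb; rewrite f0.
under eq_bigr do rewrite mulrBr expRD.
rewrite -mulr_suml.
have le1 : \sum_(s : T) expR (lam * f s) <= #|T|%:R * (1 - p + p * expR (lam * b)).
  apply: le_trans (ler_sum _ (fun (s : T) _ => expR_chord_le lam b_gt0 (f_itv s))) _.
  rewrite big_split /= sumrB -!mulr_suml sumr_const sumf /p.
  rewrite -mulr_natl le_eqVlt; apply/orP; left; apply/eqP; field.
  by rewrite gt_eqF.
have lb0 : 0 <= lam * b by rewrite mulr_ge0 // ltW.
have le2 := bernoulli_mgf_le p01 lb0.
rewrite expRN ler_pdivrMr ?expR_gt0 // -[leRHS]mulrA -expRD.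
apply: le_trans le1 _; rewrite ler_pM2l //; apply: le_trans le2 _.
rewrite ler_expR le_eqVlt; apply/orP; left; apply/eqP.
by rewrite /p; field; rewrite gt_eqF.
Qed.

(** Chernoff's method by counting: an exponential dominates the indicator of the event, and its sum
    over all tuples factors into [M] equal sums. *)
Lemma hoeffding_upper (M : nat) t : 0 < t ->
  #|[set q : {ffun 'I_M -> T} | t <= M%:R^-1 * (\sum_m f (q m)) - mean]%SET|%:R
  <= #|T|%:R ^+ M * expR (- (2 * M%:R * t ^+ 2 / b ^+ 2)) :> R.
Proof.
move=> t0; have [->|M0] := posnP M.
  rewrite expr0 mulr0 !mul0r oppr0 expR0 mulr1 (_ : 1 = 1%:R) // ler_nat.
  by apply: leq_trans (max_card _) _; rewrite card_ffun card_ord.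
have Mr0 : 0 < M%:R :> R by rewrite ltr0n.
(* This minimizes the exponent -lam M t + M lam^2 b^2 / 8; the minimum is -2 M t^2 / b^2. *)
pose lam := 4 * t / b ^+ 2.
have lam0 : 0 <= lam by rewrite divr_ge0 ?exprn_ge0 ?mulr_ge0 // ltW.
have markov : #|[set q : {ffun 'I_M -> T} | t <= M%:R^-1 * (\sum_m f (q m)) - mean]%SET|%:R
    <= \sum_(q : {ffun 'I_M -> T})
         expR (- (lam * M%:R * t)) * \prod_m expR (lam * (f (q m) - mean)) :> R.
  rewrite -sum1_card natr_sum big_mkcond /=; apply: ler_sum => q _.
  rewrite inE; case: ifP => [tq|_]; last first.
    by rewrite mulr_ge0 ?expR_ge0 // prodr_ge0 // => m _; exact: expR_ge0.
  rewrite -expR_sum -expRD; apply: le_trans (expR_ge1Dx _).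
  rewrite lerDl -mulr_sumr sumrB sumr_const card_ord.
  have tM : M%:R * t <= \sum_m f (q m) - mean *+ M.
    move: tq; rewrite lerBrDr -(ler_pM2l Mr0) mulrDr [leRHS]mulrA mulfV ?gt_eqF // mul1r.
    by rewrite lerBrDr -(mulr_natl mean).
  by rewrite addrC subr_ge0 -mulrA ler_wpM2l.
apply: le_trans markov _; rewrite -mulr_sumr.
rewrite -(bigA_distr_bigA (fun _ (s : T) => expR (lam * (f s - mean)))) /=.
rewrite prodr_const card_ord.
apply: (@le_trans _ _ (expR (- (lam * M%:R * t)) *
   (#|T|%:R * expR (lam ^+ 2 * b ^+ 2 / 8)) ^+ M)).
  rewrite ler_pM2l ?expR_gt0 //; apply: lerXn2r (mgf_le lam0); rewrite nnegrE.
    by apply: sumr_ge0 => s _; exact: expR_ge0.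
  by rewrite mulr_ge0 // expR_ge0.
rewrite exprMn mulrCA ler_wpM2l ?exprn_ge0 // -expRM_natl -expRD ler_expR.
rewrite le_eqVlt; apply/orP; left; apply/eqP.
by rewrite /lam; field; rewrite gt_eqF.
Qed.

End FiniteSample.

(** The lower tail is the upper tail of [b - f], which has the same range; hence the factor 2. *)
Lemma hoeffding (T : finType) (f : T -> R) b (M : nat) t :
  (0 < #|T|)%N -> 0 < b -> (forall s : T, 0 <= f s <= b) -> 0 < t ->
  #|[set q : {ffun 'I_M -> T} |
     t <= `|M%:R^-1 * (\sum_m f (q m)) - #|T|%:R^-1 * \sum_(s : T) f s|]%SET|%:R
  <= 2 * #|T|%:R ^+ M * expR (- (2 * M%:R * t ^+ 2 / b ^+ 2)) :> R.
Proof.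
move=> T0 b0 fb t0; have [->|M0] := posnP M.
  rewrite expr0 mulr0 !mul0r oppr0 expR0 !mulr1 ler_nat.
  by apply: leq_trans (max_card _) _; rewrite card_ffun card_ord.
have fb' (s : T) : 0 <= b - f s <= b by have := fb s; lra.
have Mr0 : M%:R != 0 :> R by rewrite pnatr_eq0 -lt0n.
have Tr0 : #|T|%:R != 0 :> R by rewrite pnatr_eq0 -lt0n.
have up := hoeffding_upper T0 b0 fb M t0.
have lo := hoeffding_upper T0 b0 fb' M t0.
rewrite -mulrA mulr_natl mulr2n; apply: le_trans (lerD up lo).
rewrite -natrD ler_nat; apply: leq_trans (leq_card_setU _ _).
apply/subset_leq_card/fintype.subsetP => q; rewrite !inE.
rewrite ler_normr => /orP[->//|tq].
apply/orP; right; apply: le_trans tq _; rewrite le_eqVlt; apply/orP; left; apply/eqP.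
have sumT : \sum_(s : T) (b - f s) = #|T|%:R * b - \sum_(s : T) f s.
  by rewrite sumrB sumr_const mulr_natl.
have sumM : \sum_m (b - f (q m)) = M%:R * b - \sum_m f (q m).
  by rewrite sumrB sumr_const card_ord mulr_natl.
by rewrite sumT sumM; field; rewrite Mr0 Tr0.
Qed.

End Hoeffding.

(** * Sampled permutations and Shapley values *)

Section Sampling.
Variables (R : realType) (d : measure_display) (Omega : measurableType d).
Variables (P : probability Omega R) (n M : nat) (X : 'I_M -> Omega -> 'S_n).
Hypotheses (X_meas : random_perms X) (X_unif : uniform_perms P X).
Hypothesis X_indep : independent_perms P X.

(** Gathering the [M] permutations into one element of a finite type turns probabilities into
    proportions of samples. *)
Definition sample (x : Omega) : {ffun 'I_M -> 'S_n} := [ffun m => X m x].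

Lemma sample_preimage1 q : sample @^-1` [set q] =
  \bigcap_(m in [set` [set: 'I_M]%SET]) (X m @^-1` [set q m]).
Proof.
apply/seteqP; split=> [x <- m _|x Xq] /=; first by rewrite ffunE.
by apply/ffunP => m; rewrite ffunE; apply: Xq => /=; rewrite inE.
Qed.

Lemma sample_measurable1 q : measurable (sample @^-1` [set q]).
Proof.
rewrite sample_preimage1; apply: fin_bigcap_measurable => // m _; exact: X_meas.
Qed.

Lemma sample_probability1 q : P (sample @^-1` [set q]) = ((n`!%:R ^+ M)^-1)%:E.
Proof.
rewrite sample_preimage1 X_indep.
under eq_bigr do rewrite X_unif.
by rewrite prodEFin prodr_const cardsT card_ord exprVn.
Qed.

Lemma sample_probability (Q : {set {ffun 'I_M -> 'S_n}}) :
  P (sample @^-1` [set` Q]) = (#|Q|%:R / n`!%:R ^+ M)%:E.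
Proof.
have -> : sample @^-1` [set` Q] = \bigcup_(q in [set` Q]) (sample @^-1` [set q]).
  apply/seteqP; split=> [x Qx|x [q Qq /= xq]]; first by exists (sample x).
  by rewrite /preimage /= xq.
rewrite measure_fin_bigcup //.
- rewrite (_ : [set` Q] = [set` enum Q]); last first.
    by apply/seteqP; split=> q /=; rewrite mem_enum.
  rewrite -fsbig_seq ?enum_uniq // big_enum.
  rewrite (eq_bigr _ (fun q _ => sample_probability1 q)).
  by rewrite sumEFin sumr_const mulr_natl.
- by move=> q q' _ _ [x [/= xq xq']]; rewrite -xq -xq'.
- by move=> q _; exact: sample_measurable1.
Qed.

Lemma sample_probability_ge (Q : {set {ffun 'I_M -> 'S_n}}) (delta : R) :
  #|~: Q|%:R <= delta * n`!%:R ^+ M ->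
  ((1 - delta)%:E <= P (sample @^-1` [set` Q]))%E.
Proof.
move=> cardNQ; rewrite sample_probability lee_fin.
have n0 : 0 < n`!%:R ^+ M :> R by rewrite exprn_gt0 // ltr0n fact_gt0.
rewrite ler_pdivlMr // mulrBl mul1r lerBlDr.
apply: (@le_trans _ _ (#|Q|%:R + #|~: Q|%:R)); last by rewrite lerD2l.
by rewrite -natrD cardsC card_ffun card_ord card_Sn natrX.
Qed.

End Sampling.

(** The union bound in counting form, used over levels and over players. *)
Lemma card_le_sum_cover (I T : finType) (B : {set T}) (F : I -> {set T}) :
  (forall q, q \in B -> exists i, q \in F i) -> (#|B| <= \sum_i #|F i|)%N.
Proof.
move=> BF; apply: (@leq_trans #|(\bigcup_i F i)%SET|).
  apply/subset_leq_card/fintype.subsetP => q /BF[i qi].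
  by apply/finset.bigcupP; exists i.
elim/big_ind2: _ => [|m A k A' Am A'k|//]; first by rewrite cards0.
exact: leq_trans (leq_card_setU _ _) (leq_add Am A'k).
Qed.

Lemma ord_neq_gt1 n (i j : 'I_n) : i != j -> (1 < n)%N.
Proof. by case: n i j => [[]//|[|//]] i j; rewrite (ord1 i) (ord1 j) eqxx. Qed.

(** * A lower bound on Shapley values from one pair of players *)

Section ShapleyBound.
Variables (R : realType) (n : nat) (v : {set 'I_n} -> R) (i : 'I_n).

Lemma notin_Prc (s : 'S_n) : i \notin Prc s i.
Proof. by rewrite inE ltnn. Qed.

Lemma card_Prc (s : 'S_n) : (#|Prc s i| <= n.-1)%N.
Proof.
have := max_card (mem (i |: Prc s i)%SET).
by rewrite cardsU1 notin_Prc card_ord add1n; case: n i s => [[]|].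
Qed.

(** The order [t] starts with [j], [i]; composing it with the permutations that fix the first two
    positions gives distinct orders with the same start. *)
Lemma card_Prc_set1 (j : 'I_n) : j != i ->
  (n.-2`! <= #|[set s : 'S_n | Prc s i == [set j]]%SET|)%N.
Proof.
move=> ji.
have n_gt1 := ord_neq_gt1 ji.
pose a0 : 'I_n := Ordinal (ltnW n_gt1); pose a1 : 'I_n := Ordinal n_gt1.
have a01 : a0 != a1 by [].
(* The left factor acts first: it sends [a1] to the point that the right factor maps to [i], and
   fixes [a0], which the right factor maps to [j]. *)
pose t : 'S_n := (tperm a1 (tperm a0 j i) * tperm a0 j)%g.
have ia0 : tperm a0 j i != a0.
  by rewrite -[X in _ != X](tpermR a0 j) (inj_eq perm_inj) eq_sym.
have ta0 : t a0 = j by rewrite permM [tperm a1 _ _]tpermD ?tpermL.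
have ta1 : t a1 = i by rewrite permM tpermL tpermK.
pose fixing := [set u : 'S_n | perm_on (~: [set a0; a1]) u]%SET.
have card_fixing : #|fixing| = n.-2`!.
  rewrite cardsE (card_perm (~: [set a0; a1]%SET)).
  by rewrite cardsCs finset.setCK cards2 a01 card_ord subn2.
rewrite -card_fixing -(card_imset _ (@mulIg _ t)); apply/subset_leq_card.
apply/fintype.subsetP => _ /imsetP[u + ->]; rewrite !inE => u_on.
have fix_out a : a \in [set a0; a1]%SET -> (u * t)%g a = t a.
  by move=> aa; rewrite permM (out_perm u_on) // finset.in_setC negbK.
have s0 : (u * t)%g a0 = j by rewrite fix_out ?ta0 // finset.set21.
have s1 : (u * t)%g a1 = i by rewrite fix_out ?ta1 // finset.set22.
apply/eqP/setP => k; rewrite !inE -{1}s1 permK -{1}s0.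
rewrite -[k in RHS](permKV (u * t)%g) (inj_eq perm_inj).
by rewrite ltnS leqn0.
Qed.

(** At least (n-2)! of the n! = n (n-1) (n-2)! orders contribute a marginal of at least 1, all
    others a nonnegative one. *)
Lemma shapley_ge (j : 'I_n) : j != i ->
  (forall S : {set 'I_n}, i \notin S -> 0 <= v (i |: S)%SET - v S) ->
  1 <= v (i |: [set j])%SET - v [set j]%SET ->
  (n%:R * (n%:R - 1))^-1 <= shapley v i.
Proof.
move=> ji v_ge0 vj.
have n_gt1 := ord_neq_gt1 ji.
have factE : n`!%:R = n%:R * (n%:R - 1) * n.-2`!%:R :> R.
  case: n n_gt1 => [//|[//|k]] _ /=.
  by rewrite !factS !natrM mulrA -[k.+2%:R]natr1 addrK.
have nn0 : 0 < n%:R * (n%:R - 1) :> R.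
  by rewrite mulr_gt0 ?subr_gt0 ?ltr1n // ltr0n ltnW.
have f0 : 0 < n.-2`!%:R :> R by rewrite ltr0n fact_gt0.
rewrite /shapley factE; set a := n%:R * _ in nn0 *.
rewrite [(a * _)^-1]invfM -mulrA ler_pMr ?invr_gt0 // ler_pdivlMl // mulr1.
apply: (@le_trans _ _ #|[set s : 'S_n | Prc s i == [set j]]%SET|%:R).
  by rewrite ler_nat card_Prc_set1.
rewrite -sum1_card natr_sum big_mkcond; apply: ler_sum => s _.
rewrite inE /marginal; case: eqP => [->//|_].
exact/v_ge0/notin_Prc.
Qed.

Lemma shapley_null : (forall s, marginal v s i = 0) -> shapley v i = 0.
Proof. by move=> v0; rewrite /shapley big1 ?mulr0. Qed.

End ShapleyBound.

(** * Linearity of Shapley values and of their estimates *)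

Section LinearCombination.
Variables (R : realType) (n H : nat) (v : {set 'I_n} -> R).
Variables (c : 'I_H -> R) (u : 'I_H -> {set 'I_n} -> R).
Hypothesis vE : forall S, v S = \sum_h c h * u h S.

Lemma marginal_sum s i : marginal v s i = \sum_h c h * marginal (u h) s i.
Proof. by rewrite /marginal !vE -sumrB; apply: eq_bigr => h _; rewrite mulrBr. Qed.

Lemma shapley_sum i : shapley v i = \sum_h c h * shapley (u h) i.
Proof.
rewrite /shapley; under eq_bigr do rewrite marginal_sum.
rewrite exchange_big mulr_sumr; apply: eq_bigr => h _.
by rewrite -mulr_sumr mulrCA.
Qed.

Lemma shapley_estimate_sum M (p : 'I_M -> 'S_n) i :
  shapley_estimate v p i = \sum_h c h * shapley_estimate (u h) p i.
Proof.
rewrite /shapley_estimate; under eq_bigr do rewrite marginal_sum.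
rewrite exchange_big mulr_sumr; apply: eq_bigr => h _.
by rewrite -mulr_sumr mulrCA.
Qed.

End LinearCombination.

(** * Relative error *)

Section PlayerError.
Variables (R : realType) (n : nat) (w : {set node n} -> R).
Hypothesis w_ge0 : forall e, e \in complete_edges [set: node n]%SET -> 0 <= w e.
Variable i : 'I_n.
Hypothesis i_non_null : ~ null_player (mcst_saving w) i.

Let v := mcst_saving w.
Let H := num_pos_weights w.
Let u (h : 'I_H) := level_game w (levels w)`_h.

Lemma saving_layers S : v S = \sum_(h < H) level_gap w h * u h S.
Proof. exact: mcst_saving_layers. Qed.

Lemma level_marginal_itv h s : 0 <= marginal (u h) s i <= n%:R - 1.
Proof.
rewrite level_marginal_ge0 ?notin_Prc //=.
apply: le_trans (level_marginal_le w _ (notin_Prc i s)) _.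
rewrite lerBrDr natr1 ler_nat.
by have := card_Prc i s; case: n i s => [[]|].
Qed.

(** One nonzero marginal yields a pair as required by [shapley_ge]. In the null alternative the
    estimate is exact, so only the other one can produce errors. *)
Lemma level_shapley_dichotomy h :
  (forall s, marginal (u h) s i = 0) \/
  (1 < n)%N /\ (n%:R * (n%:R - 1))^-1 <= shapley (u h) i.
Proof.
have [null|] := pselect (forall s, marginal (u h) s i = 0); first by left.
move=> /existsNP[s /eqP ms]; right.
have iS := notin_Prc i s.
have [|j ji uj] := @level_marginal_pair _ _ w (levels w)`_h _ _ iS.
  by rewrite -subr_eq0.
split; first exact: ord_neq_gt1 ji.
by apply: shapley_ge ji _ uj => S; exact: level_marginal_ge0.
Qed.

Lemma level_shapley_ge0 h : 0 <= shapley (u h) i.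
Proof.
rewrite mulr_ge0 ?invr_ge0 // sumr_ge0 // => s _.
by have /andP[] := level_marginal_itv h s.
Qed.

(** Otherwise [i] would be null in every level, hence in their combination [v]. *)
Lemma non_null_level : exists h, 0 < shapley (u h) i.
Proof.
apply: contrapT => noh; apply: i_non_null => S iS.
rewrite -/v !saving_layers; apply: eq_bigr => h _; congr (_ * _).
apply: contrapT => /eqP uS; apply: noh; exists h.
have [j ji uj] := level_marginal_pair iS uS.
have n_gt1 := ord_neq_gt1 ji.
have := shapley_ge ji (fun S => @level_marginal_ge0 _ _ w (levels w)`_h S i) uj.
by apply: lt_le_trans; rewrite invr_gt0 mulr_gt0 ?subr_gt0 ?ltr1n // ltr0n ltnW.
Qed.

Lemma saving_shapley_gt0 : 0 < shapley v i.
Proof.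
have [h uh] := non_null_level.
rewrite (shapley_sum saving_layers) (bigD1 h) //= ltr_pwDl //.
  by rewrite mulr_gt0 // level_gap_gt0.
by apply: sumr_ge0 => k _; rewrite mulr_ge0 ?level_shapley_ge0 // ltW // level_gap_gt0.
Qed.

(** Hoeffding's inequality with range n - 1 and deviation eps phi, where phi is the Shapley value in
    the level. As phi >= 1 / (n (n - 1)), the exponent is at least 2 M eps^2 / (n^2 (n - 1)^4),
    hence at least ln (2 / beta). *)
Lemma level_bad_card M h eps beta : 0 < eps -> 0 < beta -> 0 < shapley (u h) i ->
  n%:R ^+ 2 * (n%:R - 1) ^+ 4 * ln (2 / beta) / (2 * eps ^+ 2) <= M%:R ->
  #|[set q : {ffun 'I_M -> 'S_n} | eps * shapley (u h) i <=
      `|shapley_estimate (u h) q i - shapley (u h) i|]%SET|%:R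
  <= beta * n`!%:R ^+ M.
Proof.
move=> eps0 beta0 uh Mge.
have [null|[n_gt1 phi_ge]] := level_shapley_dichotomy h.
  by rewrite shapley_null ?ltxx in uh.
have n1 : 0 < n%:R - 1 :> R by rewrite subr_gt0 ltr1n.
have n0 : 0 < n%:R :> R by rewrite ltr0n ltnW.
have n_fact : 0 < n`!%:R ^+ M :> R by rewrite exprn_gt0 // ltr0n fact_gt0.
have Sn_gt0 : (0 < #|'S_n|)%N by rewrite card_Sn fact_gt0.
have := hoeffding M Sn_gt0 n1 (level_marginal_itv h) (mulr_gt0 eps0 uh).
rewrite card_Sn => /le_trans; apply.
rewrite mulrAC ler_pM2r // mulrC -ler_pdivlMr // -[leRHS]lnK ?posrE ?divr_gt0 //.
rewrite ler_expR -[beta / 2]invf_div lnV ?posrE ?divr_gt0 // lerN2.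
have nn0 : 0 < n%:R * (n%:R - 1) :> R by rewrite mulr_gt0.
apply: (@le_trans _ _ (2 * M%:R * (eps * (n%:R * (n%:R - 1))^-1) ^+ 2 / (n%:R - 1) ^+ 2)).
  rewrite ler_pdivrMr ?mulr_gt0 ?exprn_gt0 // in Mge.
  rewrite -(@ler_pM2l _ (n%:R ^+ 2 * (n%:R - 1) ^+ 4)) ?mulr_gt0 ?exprn_gt0 //.
  apply: le_trans Mge _; rewrite le_eqVlt; apply/orP; left; apply/eqP.
  by field; rewrite !gt_eqF.
rewrite ler_pM2r ?invr_gt0 ?exprn_gt0 // ler_wpM2l ?mulr_ge0 //.
apply: lerXn2r; rewrite ?nnegrE; last by rewrite ler_pM2l.
  by apply: mulr_ge0; rewrite ?invr_ge0 ltW.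
by apply: mulr_ge0; rewrite ltW.
Qed.

(** Each of the [H] levels may fail on a share [beta / H] of the samples. If none fails, the level
    errors weighted by the gaps sum to less than [eps] times the Shapley value. *)
Lemma player_bad_card M eps beta : 0 < eps -> 0 < beta ->
  n%:R ^+ 2 * (n%:R - 1) ^+ 4 * ln (2 * H%:R / beta) / (2 * eps ^+ 2) <= M%:R ->
  #|[set q : {ffun 'I_M -> 'S_n} |
      ~~ (`|shapley_estimate v q i - shapley v i| / shapley v i < eps)]%SET|%:R
  <= beta * n`!%:R ^+ M.
Proof.
move=> eps0 beta0 Mge; have [h0 uh0] := non_null_level.
have H0 : 0 < H%:R :> R by rewrite ltr0n (leq_ltn_trans _ (ltn_ord h0)).
(* A level with zero Shapley value gets no bad samples, since its estimate is exact. *)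
pose bad h := if 0 < shapley (u h) i then
  [set q : {ffun 'I_M -> 'S_n} | eps * shapley (u h) i <=
      `|shapley_estimate (u h) q i - shapley (u h) i|]%SET else finset.set0.
have n_fact : 0 <= n`!%:R ^+ M :> R by rewrite exprn_ge0.
have bad_le h : #|bad h|%:R <= beta / H%:R * n`!%:R ^+ M.
  rewrite /bad; case: ifP => uh; last by rewrite cards0 !mulr_ge0 ?invr_ge0 // ltW.
  apply: level_bad_card => //; first by rewrite divr_gt0.
  by rewrite invf_div [2 * (_ / _)]mulrA.
have cover q : q \in [set q : {ffun 'I_M -> 'S_n} |
    ~~ (`|shapley_estimate v q i - shapley v i| / shapley v i < eps)]%SET ->
    exists h, q \in bad h.
  rewrite inE => /negP qbad; apply: contrapT => noh; apply: qbad.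
  rewrite ltr_pdivrMr ?saving_shapley_gt0 //.
  have gap0 h : 0 < level_gap w (h : 'I_H) by exact: level_gap_gt0.
  have err_lt h : 0 < shapley (u h) i ->
      `|shapley_estimate (u h) q i - shapley (u h) i| < eps * shapley (u h) i.
    move=> uh; rewrite ltNge; apply/negP => qh; apply: noh; exists h.
    by rewrite /bad uh inE.
  have err_le h : `|shapley_estimate (u h) q i - shapley (u h) i| <= eps * shapley (u h) i.
    have [null|[n_gt1 phi_ge]] := level_shapley_dichotomy h.
      by rewrite /shapley_estimate big1 // shapley_null // !mulr0 subrr normr0.
    apply/ltW/err_lt; apply: lt_le_trans phi_ge.
    by rewrite invr_gt0 mulr_gt0 ?subr_gt0 ?ltr1n // ltr0n ltnW.
  rewrite (shapley_estimate_sum saving_layers) (shapley_sum saving_layers).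
  rewrite -sumrB mulr_sumr; apply: le_lt_trans (ler_norm_sum _ _ _) _.
  (* Null levels satisfy only the weak inequality, so strictness comes from the level [h0]. *)
  rewrite (bigD1 h0) //= [ltRHS](bigD1 h0) //=; apply: ltr_leD.
    by rewrite -mulrBr normrM gtr0_norm // mulrCA ltr_pM2l // err_lt.
  apply: ler_sum => h _.
  by rewrite -mulrBr normrM gtr0_norm // mulrCA ler_pM2l.
apply: le_trans (_ : (\sum_h #|bad h|)%:R <= _).
  by rewrite ler_nat; exact: card_le_sum_cover.
rewrite natr_sum; apply: le_trans (ler_sum _ (fun h _ => bad_le h)) _.
by rewrite sumr_const card_ord -mulrnAl -mulr_natr divfK ?gt_eqF.
Qed.

End PlayerError.

(** * Relative error of the sampled Shapley value *)

Theorem theorem4p7 (R : realType) (n : nat) (w : {set node n} -> R)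
    (w_ge0 : forall e, e \in complete_edges [set: node n]%SET -> 0 <= w e)
    (non_null : forall i : 'I_n, ~ null_player (mcst_saving w) i)
    (d : measure_display) (Omega : measurableType d) (P : probability Omega R)
    (M : nat) (M_gt0 : (0 < M)%N) (X : 'I_M -> Omega -> 'S_n)
    (X_meas : random_perms X) (X_unif : uniform_perms P X)
    (X_indep : independent_perms P X)
    (eps delta : R) (eps_gt0 : 0 < eps) (delta_gt0 : 0 < delta)
    (delta_lt1 : delta < 1) :
  let v := mcst_saving w in
  let H := num_pos_weights w in
  let phi := shapley v in
  let phiA := fun x : Omega => shapley_estimate v (fun m => X m x) in
  (n%:R ^+ 2 * (n%:R - 1) ^+ 4 * ln (2 * H%:R / delta) / (2 * eps ^+ 2) <= M%:R ->
   forall i : 'I_n,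
     ((1 - delta)%:E <= P [set x | (`|phiA x i - phi i| / phi i < eps)%R])%E)
  /\
  (n%:R ^+ 2 * (n%:R - 1) ^+ 4 * ln (2 * n%:R * H%:R / delta) / (2 * eps ^+ 2)
     <= M%:R ->
   ((1 - delta)%:E <=
     P [set x | forall i : 'I_n, (`|phiA x i - phi i| / phi i < eps)%R])%E).
Proof.
move=> v H phi phiA.
have phi_gt0 i : 0 < phi i := saving_shapley_gt0 w_ge0 (@non_null i).
have phiAE x i : phiA x i = shapley_estimate v (sample X x) i.
  by rewrite /phiA /shapley_estimate; congr (_ * _); apply: eq_bigr => m _; rewrite ffunE.
split=> [Mge i|Mge].
  set bad := [set q : {ffun 'I_M -> 'S_n} |
    ~~ (`|shapley_estimate v q i - phi i| / phi i < eps)]%SET.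
  rewrite (_ : [set x | _] = sample X @^-1` [set` (~: bad)%SET]); last first.
    by apply/seteqP; split=> x; rewrite /= !inE negbK phiAE.
  apply: sample_probability_ge => //; rewrite finset.setCK.
  exact: player_bad_card.
set bad := fun i => [set q : {ffun 'I_M -> 'S_n} |
  ~~ (`|shapley_estimate v q i - phi i| / phi i < eps)]%SET.
rewrite (_ : [set x | _] = sample X @^-1` [set` (~: \bigcup_i bad i)%SET]); last first.
  apply/seteqP; split=> x /=; rewrite inE => good.
    by apply/finset.bigcupP => -[i _]; rewrite inE -phiAE good.
  move=> i; rewrite phiAE; apply: contraNT good => xbad.
  by apply/finset.bigcupP; exists i => //; rewrite inE.
apply: sample_probability_ge => //; rewrite finset.setCK.
apply: le_trans (_ : (\sum_i #|bad i|)%:R <= _).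
  rewrite ler_nat; apply: card_le_sum_cover => q /finset.bigcupP[i _ qi].
  by exists i.
(* Without players there are no bad samples; otherwise each player is allotted [delta / n], which
   puts the factor n into the logarithm. *)
have [n0|n_gt0] := posnP n.
  rewrite big1 ?mulr_ge0 ?exprn_ge0 ?(ltW delta_gt0) // => i.
  by have := ltn_ord i; rewrite {2}n0.
have n_neq0 : n%:R != 0 :> R by rewrite pnatr_eq0 -lt0n.
have bad_le i : #|bad i|%:R <= delta / n%:R * n`!%:R ^+ M.
  apply: player_bad_card => //; first by rewrite divr_gt0 ?ltr0n.
  by rewrite invf_div [2 * H%:R * _]mulrA (mulrAC 2).
rewrite natr_sum; apply: le_trans (ler_sum _ (fun i _ => bad_le i)) _.
by rewrite sumr_const card_ord -mulrnAl -mulr_natr divfK.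
Qed.
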